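(* Let $S\subseteq\mathbb{R}^n$ be a polyhedrally-truncated affine lattice and let $B=\{r\in\mathbb{R}^n : a_i\cdot r\le 1,\ i\in I\}$ be a maximal $S$-free polyhedron with the origin in its interior. Let $M:\mathbb{R}^n\to\mathbb{R}^n$ be an invertible linear map, let $m\in\mathbb{R}^n$, and let $T$ denote the affine transformation $T(x)=M(x)+m$. Suppose that $T(B)$ also contains the origin in its interior (i.e., $a_i\cdot(-M^{-1}m)<1$ for each $i\in I$). Put $S'=T(S)$ and $B'=T(B)$. Then $R(S,B)+W_S=\mathbb{R}^n$ if and only if $R(S',B')+W_{S'}=\mathbb{R}^n$.
   Context: A lattice in $\mathbb{R}^n$ is a set $\Lambda=\{\lambda_1v_1+\dots+\lambda_nv_n:\lambda_i\in\mathbb{Z}\}$ with $v_1,\dots,v_n\in\mathbb{R}^n$ linearly independent. A truncated affine lattice is a set $S=(b+\Lambda)\cap C$ with $\Lambda$ a lattice in $\mathbb{R}^n$, $b\in\mathbb{R}^n\setminus\Lambda$ and $C\subseteq\mathbb{R}^n$ convex; it is polyhedrally-truncated if $\operatorname{conv}(S)$ is a polyhedron. A convex set $B$ is $S$-free if $\operatorname{int}(B)\cap S=\emptyset$, and maximal $S$-free if it is inclusion-wise maximal among $S$-free convex sets. A maximal $S$-free set $B$ with the origin in its interior is a polyhedron and is written $B=\{r: a_i\cdot r\le 1,\ i\in I\}$ with $I$ finite and exactly one (facet-defining) inequality for each facet of $B$. For $s\in B\cap S$, choose $k\in I$ with $a_k\cdot s=1$ (such $k$ exists because $B$ is $S$-free;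 the set below does not depend on the choice of $k$). The spindle of $s$ is $$R(s,B)=\{r\in\mathbb{R}^n:(a_i-a_k)\cdot r\le 0,\ (a_i-a_k)\cdot(s-r)\le 0\ \ \forall i\in I\},$$ and $R(S,B)=\bigcup_{s\in B\cap S}R(s,B)$. For a set $S\subseteq\mathbb{R}^n$, $W_S=\{w\in\mathbb{R}^n: s+\lambda w\in S\ \ \forall s\in S,\ \forall\lambda\in\mathbb{Z}\}$. Sums of sets are Minkowski sums. The set $B'=T(B)$ is $\{r: a_i'\cdot r\le 1,\ i\in I\}$ with $a_i'=\dfrac{(M^{-1})^*(a_i)}{1+a_i\cdot M^{-1}m}$, where $F^*$ is the adjoint (transpose) of a linear map $F$; $R(S',B')$ and $W_{S'}$ are defined by the same formulas, with $S',B',a_i'$ in place of $S,B,a_i$. *)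

(* Defs.v *)
(* R^n is the space of column vectors with entries in R. *)
From mathcomp Require Export all_boot all_order all_algebra.
From mathcomp Require Export boolp classical_sets reals topology normedtype.
From mathcomp Require Export convex.

Set Implicit Arguments.
Unset Strict Implicit.
Unset Printing Implicit Defensive.

Export Order.TTheory GRing.Theory Num.Theory.
Export numFieldNormedType.Exports.
#[export] Set Implicit Arguments.
#[export] Unset Strict Implicit.
#[export] Unset Printing Implicit Defensive.

Local Open Scope classical_set_scope.
Local Open Scope ring_scope.

Section Definitions.
Context {R : realType} {n : nat}.
Notation V := 'cV[R]_n.
Implicit Types (A B C F K L P S : set V) (a b c m r s w x y : V) (M : 'M[R]_n).

Definition dot x y : R := (x^T *m y) 0 0.

Definition is_convex A : Prop := @convex_set R V A.

Definition conv_hull A : set V := smallest is_convex A.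

Definition is_polyhedron P : Prop :=
  exists (k : nat) (c : 'I_k -> V) (d : 'I_k -> R),
    P = [set r | forall i, dot (c i) r <= d i].

Definition is_lattice L : Prop :=
  exists2 v : n.-tuple V, free v &
    L = [set x | exists l : 'I_n -> int, x = \sum_(i < n) (l i)%:~R *: v`_i].

Definition truncated_affine_lattice S : Prop :=
  exists L b C, [/\ is_lattice L, ~ L b, is_convex C &
    S = [set b + x | x in L] `&` C].

Definition polyhedrally_truncated_affine_lattice S : Prop :=
  truncated_affine_lattice S /\ is_polyhedron (conv_hull S).

Definition free_convex S B : Prop := is_convex B /\ B° `&` S = set0.

Definition maximal_free S B : Prop :=
  free_convex S B /\
  forall K, free_convex S K -> B `<=` K -> K `<=` B.

Definition affinely_independent (d : nat) (p : 'I_d.+1 -> V) : Prop :=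
  free [tuple p (lift ord0 i) - p ord0 | i < d].

(* No natural number is the dimension of the empty set. *)
Definition has_affine_dim A (d : nat) : Prop :=
  (exists2 p : 'I_d.+1 -> V, (forall i, A (p i)) & affinely_independent p) /\
  (forall p : 'I_d.+2 -> V, (forall i, A (p i)) -> ~ affinely_independent p).

Definition is_face P F : Prop :=
  exists (c : V) (d : R), (forall r, P r -> dot c r <= d) /\
    F = P `&` [set r | dot c r = d].

Definition is_facet P F : Prop :=
  is_face P F /\ exists d, has_affine_dim P d.+1 /\ has_affine_dim F d.

(* B = {r : a_i . r <= 1, i in I}, where every inequality defines a facet and
   every facet is defined by exactly one of the inequalities. *)
Definition facet_description (I : finType) (a : I -> V) B : Prop :=
  [/\ B = [set r | forall i, dot (a i) r <= 1],
      forall i, is_facet B (B `&` [set r | dot (a i) r = 1]) &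
      forall F, is_facet B F ->
        exists! i, F = B `&` [set r | dot (a i) r = 1]].

Definition spindle_at (I : finType) (a : I -> V) (k : I) s : set V :=
  [set r | forall i, dot (a i - a k) r <= 0 /\ dot (a i - a k) (s - r) <= 0].

(* The choice of k is immaterial. *)
Lemma spindle_at_indep (I : finType) (a : I -> V) (k l : I) s :
  dot (a k) s = 1 -> dot (a l) s = 1 -> spindle_at a k s = spindle_at a l s.
Proof.
have dotB (x y z : V) : dot (x - y) z = dot x z - dot y z.
  by rewrite /dot linearB /= mulmxBl !mxE.
have dotBr (x y z : V) : dot x (y - z) = dot x y - dot x z.
  by rewrite /dot mulmxBr !mxE.
suff sub k' l' : dot (a k') s = 1 -> dot (a l') s = 1 ->
    spindle_at a k' s `<=` spindle_at a l' s.
  by move=> ks ls; apply/seteqP; split; apply: sub.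
move=> ks ls r kr i.
have := kr l'; have := kr i; rewrite !dotB !dotBr ks ls.
move=> [h1 h2] [h3 h4].
have e : dot (a l') r = dot (a k') r.
  apply/eqP; rewrite eq_le -subr_le0 h3 /=.
  by move: h4; rewrite lerBlDr add0r lerD2l lerN2.
by rewrite e.
Qed.

Definition spindle (I : finType) (a : I -> V) s : set V :=
  [set r | exists2 k, dot (a k) s = 1 & spindle_at a k s r].

(* R(S, B), where a is the facet description of B. *)
Definition spindle_region S B (I : finType) (a : I -> V) : set V :=
  \bigcup_(s in B `&` S) spindle a s.

Definition lattice_translations S : set V :=
  [set w | forall s, S s -> forall l : int, S (s + l%:~R *: w)].

Definition minkowski_sum A B : set V := [set x + y | x in A & y in B].

Definition affine_map M m : V -> V := fun x => M *m x + m.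

(* a_i' = (M^-1)^* a_i / (1 + a_i . M^-1 m), which describe the image of
   {r : a_i . r <= 1} under x |-> M x + m; the adjoint is the transpose. *)
Definition transformed_normals (I : finType) (a : I -> V) M m : I -> V :=
  fun i => (1 + dot (a i) (invmx M *m m))^-1 *: ((invmx M)^T *m a i).

End Definitions.

(* Main.v *)
Require Import Defs.
From mathcomp Require Import ring lra.

(** Write v = M^-1 m. The hypothesis that T(B) has the origin in its interior
    amounts to 1 + a_i . v > 0 for every i. Since T^-1 is a map of the same
    kind, which takes S', B', a' back to S, B, a, one implication suffices: if
    the translates of the spindles of B cover the space, so do those of B'.

    On the spindle of s, with a_k . s = 1, consider the linear map
    r |-> M (r + (a_k . r) v). The normals a' are such that it carries R(s, B)
    into R(T s, B') ([covering_affine_image]). If the translates of the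
    spindles cover the space, these maps glue to a single map: put
    f(x) = a_k . r when x = r + w with r in the spindle of s and w in W_S, and
    send x to M (x + f(x) v). A point s + w is sent to M (s + v) + M w, and
    M W_S is contained in W_S', so the image of this map lies in
    R(S', B') + W_S'. It remains to prove that x |-> x + f(x) v is onto.

    The key is the inequality
      f(y) - f(x) <= max_i a_i . (y - x)     ([lifted_value_increment]),
    which comes from a collision argument: writing x = r1 + w1 and
    y = r2 + w2, with r2 in the spindle of s2, the point s2 + w2 - w1 is in S,
    hence not in the interior of B, so some a_i is at least 1 on it.
    For x = y it says that f does not depend on the decompositions chosen.

    To reach z, look for x = z - t v, that is for t with f(z - t v) = t. By the
    inequality, t |-> f(z - t v) is Lipschitz and its slopes are at most
    max_i (- a_i . v) < 1, so t - f(z - t v) changes sign and the intermediate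
    value theorem applies ([shear_surjective]). Thus surjectivity reduces to
    real functions of one variable, lines parallel to v being preserved. *)

Local Open Scope classical_set_scope.
Local Open Scope ring_scope.

(** * The dot product *)

Section DotProduct.
Context {R : realType} {n : nat}.
Implicit Types (x y z : 'cV[R]_n) (c : R) (N : 'M[R]_n).

Lemma dotDr x y z : dot x (y + z) = dot x y + dot x z.
Proof. by rewrite /dot mulmxDr mxE. Qed.

Lemma dotBr x y z : dot x (y - z) = dot x y - dot x z.
Proof. by rewrite /dot mulmxBr !mxE. Qed.

Lemma dotZr c x y : dot x (c *: y) = c * dot x y.
Proof. by rewrite /dot -scalemxAr mxE. Qed.

Lemma dotNr x y : dot x (- y) = - dot x y.
Proof. by rewrite /dot mulmxN mxE. Qed.

Lemma dotBl x y z : dot (x - y) z = dot x z - dot y z.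
Proof. by rewrite /dot linearB mulmxBl !mxE. Qed.

Lemma dotZl c x y : dot (c *: x) y = c * dot x y.
Proof. by rewrite /dot linearZ -scalemxAl mxE. Qed.

Lemma dot_trmx N x y : dot (N^T *m x) y = dot x (N *m y).
Proof. by rewrite /dot trmx_mul trmxK mulmxA. Qed.

Lemma dotE x y : dot x y = \sum_j x j 0 * y j 0.
Proof. by rewrite /dot mxE; apply: eq_bigr => j _; rewrite mxE. Qed.

Lemma dot_self_gt0 x : x != 0 -> 0 < dot x x.
Proof.
move=> x0; have sq j : 0 <= x j 0 * x j 0 by rewrite -expr2 sqr_ge0.
rewrite lt_def dotE sumr_ge0 // andbT; apply: contra x0 => /eqP s0.
apply/eqP/colP => j; rewrite mxE; apply/eqP.
by rewrite -sqrf_eq0 expr2; apply/eqP/(psumr_eq0P _ s0).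
Qed.

Lemma dot_continuous x : continuous (dot x).
Proof.
have sum_continuous (js : seq 'I_n) :
    continuous (fun y : 'cV[R]_n => \sum_(j <- js) x j 0 * y j 0).
  elim: js => [|j js IH] y.
    have -> : (fun z : 'cV[R]_n => \sum_(j <- [::]) x j 0 * z j 0) = fun=> 0.
      by apply/funext => z; rewrite big_nil.
    exact: cst_continuous.
  have -> : (fun z : 'cV[R]_n => \sum_(i <- j :: js) x i 0 * z i 0) =
      (fun z => x j 0 * z j 0 + \sum_(i <- js) x i 0 * z i 0).
    by apply/funext => z; rewrite big_cons.
  by apply: cvgD (IH y); apply: cvgMr; exact: coord_continuous.
have -> : dot x = fun y => \sum_j x j 0 * y j 0.
  by apply/funext => y; exact: dotE.
exact: sum_continuous.
Qed.

End DotProduct.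

(** * A fixed point on the real line *)

(** The graph of g meets the diagonal: to the right of 0 it stays below the
    line of slope c < 1 through (0, g 0), to the left of 0 above that line. The
    two bounds on the slopes together make g Lipschitz, hence continuous. *)
Lemma exists_fixpoint_slope_lt1 (R : realType) (g : R -> R) (c K : R) :
  c < 1 -> (forall s t, s <= t -> - K * (t - s) <= g t - g s <= c * (t - s)) ->
  exists t, g t = t.
Proof.
move=> c1 slope.
pose L := `|K| + `|c| + 1.
have L0 : 0 < L by rewrite /L; have := normr_ge0 K; have := normr_ge0 c; lra.
have lip s t : `|g s - g t| <= L * `|s - t|.
  wlog st : s t / s <= t.
    by move=> H; case: (leP s t) => [|/ltW] /H //; rewrite distrC (distrC t).
  rewrite distrC (distrC s) (@ger0_norm _ (t - s)) ?subr_ge0 //.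
  have /andP[lo up] := slope _ _ st.
  have ts : 0 <= t - s by rewrite subr_ge0.
  have hK : K * (t - s) <= `|K| * (t - s) by rewrite ler_wpM2r ?ler_norm.
  have hc : c * (t - s) <= `|c| * (t - s) by rewrite ler_wpM2r ?ler_norm.
  have pK : 0 <= `|K| * (t - s) by rewrite mulr_ge0.
  have pc : 0 <= `|c| * (t - s) by rewrite mulr_ge0.
  rewrite ler_norml /L !mulrDl; apply/andP; split; lra.
have g_cont : continuous g.
  move=> s; apply/cvgrPdist_le => e e0; near=> t.
  rewrite (le_trans (lip _ _)) // mulrC -ler_pdivlMr //.
  near: t; apply: cvgr_dist_le; first exact: cvg_id.
  by rewrite divr_gt0.
(* At distance u from 0, the gap (1 - c) u between the diagonal and a line of
   slope c has made up for the value g 0. *)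
pose u := `|g 0| / (1 - c).
have c1' : 0 < 1 - c by rewrite subr_gt0.
have u0 : 0 <= u by rewrite divr_ge0 // ltW.
have uE : (1 - c) * u = `|g 0| by rewrite mulrC divfK // gt_eqF.
have up : g u - u <= 0.
  have /andP[_] := slope _ _ u0; rewrite subr0.
  by have := ler_norm (g 0); lra.
have lo : 0 <= g (- u) + u.
  have u0' : - u <= 0 by rewrite oppr_le0.
  have /andP[_] := slope _ _ u0'.
  by have := ler_norm (- g 0); rewrite normrN; lra.
have h_cont : continuous (fun t => g t - t).
  by move=> t; apply: cvgB; [exact: g_cont | exact: cvg_id].
have uu : - u <= u by lra.
have zero_mid : Num.min (g (- u) - - u) (g u - u) <= 0 <=
    Num.max (g (- u) - - u) (g u - u).
  by rewrite ge_min le_max; apply/andP; split; apply/orP; [right|left]; lra.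
have [t _ /eqP] := IVT uu (continuous_subspaceT h_cont) zero_mid.
by rewrite subr_eq0 => /eqP ?; exists t.
Unshelve. all: by end_near. Qed.

(** * The covering property and affine maps *)

Section Covering.
Context {R : realType} {n : nat} {I : finType}.
Implicit Types (S B : set 'cV[R]_n) (a : I -> 'cV[R]_n) (M : 'M[R]_n).
Implicit Types (m v x y z : 'cV[R]_n) (f : 'cV[R]_n -> R).

Definition covering S B a : Prop :=
  minkowski_sum (spindle_region S B a) (lattice_translations S) = setT.

(** For the normals a of a polyhedron B, this is S-freeness of B read off
    from the inequalities. *)
Definition normals_block S a : Prop :=
  forall s, S s -> exists i, 1 <= dot (a i) s.

Lemma free_convex_normals_block S B a :
  B = [set r | forall i, dot (a i) r <= 1] -> free_convex S B ->
  normals_block S a.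
Proof.
move=> BE [_ BS0] s Ss; apply: contrapT => noi.
have lt1 i : dot (a i) s < 1.
  by rewrite ltNge; apply/negP => ai; apply: noi; exists i.
have near_le1 : \forall x \near s, forall i, dot (a i) x <= 1.
  apply: (@filter_forall _ I (fun i x => dot (a i) x <= 1) _ (nbhs_filter s)).
  move=> i; have cts := @dot_continuous R n (a i) s.
  apply: (cts [set t | t <= 1]).
  by apply: filterS (lt_nbhsl (lt1 i)) => x /ltW.
suff : (B° `&` S) s by rewrite BS0.
by split=> //; rewrite BE.
Qed.

(** Since 0 is interior to T(B), the point - M^-1 m can be moved a little in
    the direction a_i without leaving B, which makes a_i . (- M^-1 m) <= 1 a
    strict inequality. *)
Lemma interior_image_normals_gt0 B a M m i :
  B `<=` [set r | forall i, dot (a i) r <= 1] -> M \in unitmx ->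
  ((affine_map M m @` B)° 0) -> 0 < 1 + dot (a i) (invmx M *m m).
Proof.
move=> BE Mu int0.
have near_img : \forall t \near 0^'+, (affine_map M m @` B) (t *: (M *m a i)).
  have : t *: (M *m a i) @[t --> (0 : R)^'+] --> (0 : R) *: (M *m a i).
    by apply: cvg_at_right_filter; exact: scalel_continuous.
  by rewrite scale0r => to0; exact: (to0 _ int0).
have [t [t0 [b Bb bE]]] := filter_ex (filterI (nbhs_right_gt 0) near_img).
have {bE} bE : b = t *: a i - invmx M *m m.
  rewrite -(mulKmx Mu b) -(addrK m (M *m b)) [_ + m]bE.
  by rewrite mulmxBr -scalemxAr mulKmx.
have := BE _ Bb i; rewrite bE dotBr dotZr => le1.
have [->|a0] := eqVneq (a i) 0; first by rewrite /dot trmx0 mul0mx mxE addr0.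
by have := mulr_gt0 t0 (dot_self_gt0 a0); lra.
Qed.

(** The value at x = r + w of the function that equals r |-> a_k . r on the
    spindle of s and is periodic under W_S. It is a relation because x may
    have several decompositions. *)
Definition lifted_value S B a x (c : R) : Prop :=
  exists s k r w, [/\ (B `&` S) s, dot (a k) s = 1, spindle_at a k s r,
    lattice_translations S w & x = r + w /\ c = dot (a k) r].

Lemma covering_lifted_value S B a : covering S B a ->
  exists f, forall x, lifted_value S B a x (f x).
Proof.
move=> cov.
suff /choice[f fP] : forall x, exists c, lifted_value S B a x c by exists f.
move=> x; have : [set: 'cV[R]_n] x by [].
rewrite -cov => -[r [s BSs [k ks kr]] [w Ww <-]].
by exists (dot (a k) r), s, k, r, w.
Qed.

(** The point p = s2 + w2 - w1 of S equals (s2 - r2) + r1 + (y - x). The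
    defining inequalities of the two spindles bound a_i . (s2 - r2) by 1 - d
    and a_i . r1 by c, for every i, so that a_i . p >= 1 gives the claim. *)
Lemma lifted_value_increment S B a x y c d : normals_block S a ->
  lifted_value S B a x c -> lifted_value S B a y d ->
  exists i, d - c <= dot (a i) (y - x).
Proof.
move=> block [s1 [k [r1 [w1 [_ ks1 kr1 W1 [-> ->]]]]]].
move=> [s2 [l [r2 [w2 [[_ Ss2] ls2 lr2 W2 [-> ->]]]]]].
have Sp : S (s2 + w2 - w1).
  by have := W1 _ (W2 _ Ss2 1) (-1); rewrite scale1r scaleN1r.
have [i] := block _ Sp.
have [+ _] := kr1 i; have [_ +] := lr2 i.
rewrite !dotBl !dotBr !dotDr ls2 => H1 H2 H3.
by exists i; rewrite dotBr !dotDr; lra.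
Qed.

(** Each line parallel to v is mapped to itself, so z is sought as the image
    of a point z - t v; this is a fixed point of t |-> f (z - t v). *)
Lemma shear_surjective a f v :
  (forall i, 0 < 1 + dot (a i) v) ->
  (forall x y, exists i, f y - f x <= dot (a i) (y - x)) ->
  forall z, exists x, x + f x *: v = z.
Proof.
move=> av fP z.
(* Only c < 1 is wanted from the upper slope, so 0 is a harmless start value
   for the maxima, which also covers an empty family of normals. *)
pose c := \big[Num.max/0]_i (- dot (a i) v).
pose K := \big[Num.max/0]_i dot (a i) v.
have [| |t ft] := @exists_fixpoint_slope_lt1 R (fun t => f (z - t *: v)) c K.
- by apply: bigmax_lt => // i _; have := av i; lra.
- move=> s t st; have ts : 0 <= t - s by rewrite subr_ge0.
  have E p q : z - p *: v - (z - q *: v) = (q - p) *: v.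
    by rewrite scalerBl opprB addrC addrA subrK addrC.
  apply/andP; split.
    have [i] := fP (z - t *: v) (z - s *: v); rewrite E dotZr => H.
    have : dot (a i) v <= K by exact: (le_bigmax 0 (fun i => dot (a i) v)).
    by move/(ler_wpM2l ts); lra.
  have [i] := fP (z - s *: v) (z - t *: v); rewrite E dotZr => H.
  have : - dot (a i) v <= c by exact: (le_bigmax 0 (fun i => - dot (a i) v)).
  by move/(ler_wpM2l ts); lra.
by exists (z - t *: v); rewrite ft subrK.
Qed.

Lemma dot_transformed_normals a M m i x : M \in unitmx ->
  dot (transformed_normals a M m i) (M *m x) =
  (1 + dot (a i) (invmx M *m m))^-1 * dot (a i) x.
Proof. by move=> Mu; rewrite dotZl dot_trmx mulKmx. Qed.

(** For v = M^-1 m and r' = M (r + (a_k . r) v),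
      (a'_i - a'_k) . r' = (a_i - a_k) . r / (1 + a_i . v),
    and T s = M (s + v) is the image of s in this way when a_k . s = 1. The
    factor being positive, r' is in the spindle of T s when r is in that of
    s. *)
Lemma covering_affine_image S B a M m :
  M \in unitmx -> (forall i, 0 < 1 + dot (a i) (invmx M *m m)) ->
  normals_block S a -> covering S B a ->
  covering (affine_map M m @` S) (affine_map M m @` B)
    (transformed_normals a M m).
Proof.
move=> Mu av block cov.
have [f frep] := covering_lifted_value cov.
have fP x y := lifted_value_increment block (frep x) (frep y).
rewrite /covering -subTset => y _.
pose v := invmx M *m m.
have mE : m = M *m v by rewrite mulKVmx.
have [x xz] := shear_surjective av fP (invmx M *m y).
have [s [k [r [w [[Bs Ss] ks kr Ww [xE fE]]]]]] := frep x.
exists (M *m (r + dot (a k) r *: v)).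
  exists (affine_map M m s); first by split; exists s.
  have TsE : affine_map M m s = M *m (s + v) by rewrite mulmxDr -mE.
  rewrite TsE; exists k.
    rewrite dot_transformed_normals // dotDr ks mulVf //.
    by rewrite gt_eqF ?av.
  move=> i; have [H1 H2] := kr i; move: H1 H2.
  rewrite -mulmxBr !dotBl !dot_transformed_normals // !(dotBr,dotDr,dotZr) -/v ks.
  move=> H1 H2.
  have := av i; have := av k; rewrite -/v => vk vi.
  have nk := lt0r_neq0 vk; have ni := lt0r_neq0 vi.
  (* a'_k takes the same value on the sheared point as a_k on r. *)
  have -> : (1 + dot (a k) v)^-1 * (dot (a k) r + dot (a k) r * dot (a k) v) =
     dot (a k) r by field.
  have -> : (1 + dot (a k) v)^-1 * (1 + dot (a k) v -
      (dot (a k) r + dot (a k) r * dot (a k) v)) =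
     1 - dot (a k) r by field.
  rewrite !subr_le0 !ler_pdivrMl //; split; lra.
exists (M *m w).
  move=> _ [s' Ss' <-] l; exists (s' + l%:~R *: w); first exact: Ww.
  by rewrite /affine_map mulmxDr -scalemxAr addrAC.
by rewrite -mulmxDr addrAC -xE -fE xz mulKVmx.
Qed.

Lemma normals_block_affine_image S a M m :
  M \in unitmx -> (forall i, 0 < 1 + dot (a i) (invmx M *m m)) ->
  normals_block S a ->
  normals_block (affine_map M m @` S) (transformed_normals a M m).
Proof.
move=> Mu av block _ [s Ss <-]; have [i ai] := block s Ss; exists i.
rewrite /affine_map -{2}(mulKVmx Mu m) -mulmxDr dot_transformed_normals // dotDr.
by rewrite ler_pdivlMl //; lra.
Qed.

Lemma affine_mapK M m : M \in unitmx ->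
  cancel (affine_map M m) (affine_map (invmx M) (- (invmx M *m m))).
Proof. by move=> Mu x; rewrite /affine_map mulmxDr mulKmx // addrK. Qed.

(** The denominators for T and for T^-1 are reciprocal, so that the scalings
    of the normals cancel in [transformed_normalsK]. *)
Lemma transformed_normals_inv_denominator a M m i :
  M \in unitmx -> 0 < 1 + dot (a i) (invmx M *m m) ->
  1 + dot (transformed_normals a M m i)
        (invmx (invmx M) *m - (invmx M *m m)) =
  (1 + dot (a i) (invmx M *m m))^-1.
Proof.
move=> Mu av; rewrite invmxK dot_transformed_normals // dotNr.
by field; rewrite lt0r_neq0.
Qed.

Lemma transformed_normalsK a M m :
  M \in unitmx -> (forall i, 0 < 1 + dot (a i) (invmx M *m m)) ->
  transformed_normals (transformed_normals a M m)
    (invmx M) (- (invmx M *m m)) = a.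
Proof.
move=> Mu av; apply/funext => i.
rewrite {1}/transformed_normals transformed_normals_inv_denominator // invrK invmxK.
rewrite -scalemxAr scalerA mulfV ?lt0r_neq0 // scale1r.
by rewrite mulmxA -trmx_mul mulVmx // trmx1 mul1mx.
Qed.

End Covering.

Theorem theorem3p1 (R : realType) (n : nat) (S : set 'cV[R]_n)
  (I : finType) (a : I -> 'cV[R]_n) (B : set 'cV[R]_n)
  (M : 'M[R]_n) (m : 'cV[R]_n) :
  polyhedrally_truncated_affine_lattice S ->
  maximal_free S B ->
  facet_description a B ->
  B° 0 ->
  M \in unitmx ->
  let T := affine_map M m in
  let S' := T @` S in
  let B' := T @` B in
  let a' := transformed_normals a M m in
  B'° 0 ->
  minkowski_sum (spindle_region S B a) (lattice_translations S) = setT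
  <->
  minkowski_sum (spindle_region S' B' a') (lattice_translations S') = setT.
Proof.
move=> _ [Bfree _] [BE _ _] _ Mu T S' B' a' int0.
have block := free_convex_normals_block BE Bfree.
have av i : 0 < 1 + dot (a i) (invmx M *m m).
  by apply: interior_image_normals_gt0 int0; rewrite // BE.
split; first exact: covering_affine_image.
have TK (A : set 'cV[R]_n) :
    affine_map (invmx M) (- (invmx M *m m)) @` (T @` A) = A.
  rewrite image_comp (_ : _ \o _ = id) ?image_id //.
  by apply/funext => x; exact: affine_mapK.
move=> cov; rewrite -[S]TK -[B]TK -(transformed_normalsK Mu av).
apply: covering_affine_image => //; first by rewrite unitmx_inv.
  by move=> i; rewrite transformed_normals_inv_denominator // invr_gt0.
exact: normals_block_affine_image.
Qed.
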